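(* Let $X$ be a real Banach space, let $f: X \to \mathbb{R}\cup\{+\infty\}$ be a proper lower semicontinuous convex function, let $\bar{x}\in\operatorname{dom}f$, $r>0$ and $\ell\geq 0$. Then the following three statements are equivalent: (i) $f$ is $\ell$-Lipschitz on $\operatorname{dom}f\cap B(\bar{x};r)$; (a) $\emptyset\neq\partial f(x) \subset N_{\ell}(x; \operatorname{dom}f)$ for all $x\in\operatorname{dom}f\cap B(\bar{x};r)$; (b) $\partial f(x) \cap N_{\ell}(x; \operatorname{dom}f)\neq\emptyset$ for all $x\in\operatorname{dom}f\cap B(\bar{x};r)$.
   Context: $X^*$ is the continuous dual of $X$ with its dual norm, and $B(x;r)=\{y\in X:\|x-y\|<r\}$. For $f:X\to\mathbb{R}\cup\{+\infty\}$, $\operatorname{dom}f=\{x\in X: f(x)\in\mathbb{R}\}$; $f$ is proper if $\operatorname{dom} f\neq\emptyset$, convex (resp. lower semicontinuous) if its epigraph $\{(x,r)\in X\times\mathbb{R}: f(x)\le r\}$ is convex (resp. closed in $X\times\mathbb{R}$). For a nonempty set $S\subset X$, $f$ is $\ell$-Lipschitz on $S$ if $f$ is finite on $S$ and $|f(x)-f(y)|\le \ell\|x-y\|$ for all $x,y\in S$. The subdifferential of $f$ at $x$ with $f(x)$ finite is $\partial f(x)=\{x^*\in X^*: f(y)-f(x)\ge\langle x^*,y-x\rangle\ \forall y\in X\}$. For a nonempty convex set $\Omega\subset X$, $x\in\Omega$ and $\varepsilon\ge 0$, the set of $\varepsilon$-normals to $\Omega$ at $x$ is $N_\varepsilon(x;\Omega)=\{x^*\in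 X^*:\langle x^*, y-x\rangle\leq\varepsilon\|y-x\|\text{ for all } y\in \Omega\}$. *)

(* Defs.v *)
From mathcomp Require Import all_boot all_order all_algebra.
From mathcomp Require Import all_classical all_reals all_analysis.
Import Order.TTheory GRing.Theory Num.Theory.
Import numFieldNormedType.Exports.

Set Implicit Arguments.
Unset Strict Implicit.
Unset Printing Implicit Defensive.

Local Open Scope classical_set_scope.
Local Open Scope ring_scope.

(* Functions X -> R U {+oo} are modelled as f : X -> \bar R; the hypothesis
   that f never takes the value -oo is not part of the definitions below and
   has to be stated separately. *)
Section convex_analysis.
Context {R : realType} {X : normedModType R}.
Implicit Types (f : X -> \bar R) (S Omega : set X) (x : X).

Definition edom f : set X := [set x | f x \is a fin_num].

Definition proper_fun f : Prop := edom f !=set0.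

Definition epigraph f : set (X * R^o)%type :=
  [set p | (f p.1 <= p.2%:E)%E].

Definition convex_fun f : Prop :=
  convex_set (epigraph f : set (convex_lmodType (X * R^o)%type)).

(* Epigraph form, for the product topology on X * R; the library's
   [lower_semicontinuous] uses openness of strict superlevel sets instead. *)
Definition lsc_fun f : Prop := closed (epigraph f).

Definition lipschitz_finite (ell : R) S f : Prop :=
  S `<=` edom f /\ ell.-lipschitz_S (fine \o f : X -> R^o).

Definition continuous_dual : set {linear X -> R^o} := [set u | continuous u].

(* Only meaningful when f x is finite. *)
Definition subdifferential f x : set {linear X -> R^o} :=
  continuous_dual `&` [set u | forall y, (f y - f x >= (u (y - x))%:E)%E].

Definition eps_normals (eps : R) x Omega : set {linear X -> R^o} :=
  continuous_dual `&` [set u | forall y, Omega y -> u (y - x) <= eps * `|y - x|].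

End convex_analysis.

(* Main.v *)
Require Import Defs.
From HB Require Import structures.
From mathcomp Require Import all_boot all_order all_algebra.
From mathcomp Require Import all_classical all_reals all_analysis.
From mathcomp Require Import lra.
Import Order.TTheory GRing.Theory Num.Theory.
Import numFieldNormedType.Exports.

Local Open Scope classical_set_scope.
Local Open Scope ring_scope.

(** Why the equivalence holds.

    (i) -> (a).  A convex function that is ell-Lipschitz on the part of its
    domain in a ball satisfies [f y >= f x - ell * |y - x|] for x in that part
    and every y in the domain: a short piece of the segment from x to y lies
    in the ball, the slope of f along it is at least - ell, and slopes of
    convex functions increase.  For a subgradient u at x, the same short piece
    bounds [u (y - x)] from above by [ell * |y - x|], so u is an ell-normal.
    Existence of a subgradient is the main point ([supporting_functional]):
    the functional
      p h = inf { t * (f z - f x) + ell * |h - t *: (z - x)| :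
                  z in dom f, t >= 0 }
    is finite by the lower bound on f and sublinear by convexity of f.  By
    Hahn-Banach some linear u lies below p.  Taking t = 0 gives
    [u h <= ell * |h|], hence continuity, and taking h = z - x, t = 1 gives
    the subgradient inequality.

    (a) -> (b) is immediate.

    (b) -> (i).  Given x and y in the ball and z = (1 - t) *: x + t *: y with
    t < 1, take u at z that is both a subgradient and an ell-normal.  Since
    y - z is a positive multiple of y - x, normality gives
    [u (y - x) <= ell * |y - x|], and the subgradient inequality at the other
    end x gives [f z <= f x + t * u (y - x)].  Lower semicontinuity lets t tend
    to 1 ([lsc_fun_closed_segment]).

    Hahn-Banach is obtained by minimality rather than by extending from
    subspaces: Zorn's lemma gives a minimal sublinear functional below p
    ([sublinear_minimal]), and a minimal sublinear functional is linear
    ([minimal_superadditive]).  All the sublinear functionals needed are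
    infima over convex cones, so they come from the single lemma
    [sublinear_inf]. *)

(** * Sublinear functionals and the Hahn-Banach theorem *)

(** Only the inequality is asked for in positive homogeneity, because it is
    what infima inherit; equality follows ([sublinearZ]) by scaling back. *)
Definition sublinear {R : realType} {V : lmodType R} (p : V -> R) : Prop :=
  (forall x y, p (x + y) <= p x + p y) /\
  (forall a x, 0 <= a -> p (a *: x) <= a * p x).

Section sublinear_theory.
Context {R : realType} {V : lmodType R}.
Implicit Types (p q : V -> R) (x y h : V).

Lemma sublinear0 p : sublinear p -> p 0 = 0.
Proof.
move=> [pD pZ]; apply/eqP; rewrite eq_le; apply/andP; split.
  by have := pZ 0 0 (lexx 0); rewrite scale0r mul0r.
by have := pD 0 0; rewrite addr0 -lerBlDl subrr.
Qed.

Lemma sublinearZ p a x : sublinear p -> 0 <= a -> p (a *: x) = a * p x.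
Proof.
move=> sp; have [pD pZ] := sp; rewrite le_eqVlt => /predU1P[<-|a0].
  by rewrite scale0r mul0r sublinear0.
apply/eqP; rewrite eq_le pZ ?(ltW a0)//= -ler_pdivlMl//.
have := pZ a^-1 (a *: x); rewrite scalerA mulVf ?gt_eqF// scale1r; apply.
by rewrite invr_ge0 ltW.
Qed.

Lemma sublinear_geN p x : sublinear p -> - p (- x) <= p x.
Proof.
move=> sp; have [pD _] := sp; rewrite -subr_ge0 opprK.
by rewrite -(sublinear0 _ sp) -(subrr x) pD.
Qed.

(** The pairs (h, s) with [F h s] form a convex cone, and the infimum of its
    vertical fibres is the largest functional whose epigraph contains it. *)
Lemma sublinear_inf (F : V -> set R) :
  (forall h, F h !=set0) -> (forall h, has_lbound (F h)) ->
  (forall h k s t, F h s -> F k t -> F (h + k) (s + t)) ->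
  (forall a h s, 0 <= a -> F h s -> F (a *: h) (a * s)) ->
  sublinear (fun h => inf (F h)).
Proof.
move=> F0 Fb FD FZ; split=> [h k|a h].
  rewrite -lerBlDr; apply: lb_le_inf => // s Fs.
  rewrite lerBlDl -lerBlDr; apply: lb_le_inf => // t Ft.
  by rewrite lerBlDl; apply: ge_inf => //; exact: FD.
rewrite le_eqVlt => /predU1P[<-|a0].
  have [s Fs] := F0 h; rewrite mul0r; apply: ge_inf => //.
  by rewrite -[X in F _ X](mul0r s); exact: FZ.
rewrite -ler_pdivrMl//; apply: lb_le_inf => // s Fs.
by rewrite ler_pdivrMl//; apply: ge_inf => //; apply: FZ => //; exact: ltW.
Qed.

(** Zorn's lemma, where the pointwise infimum of a nonempty chain is finite
    because every sublinear q below p satisfies [q h >= - p (- h)]. *)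
Lemma sublinear_minimal p : sublinear p -> exists q,
  [/\ sublinear q, forall x, q x <= p x &
      forall q', sublinear q' -> (forall x, q' x <= q x) ->
      forall x, q x <= q' x].
Proof.
move=> sp; pose P (q : V -> R) := sublinear q /\ forall x, q x <= p x.
pose T := {q | P q}; have pT : P p by [].
pose le (a b : T) := `[< forall x, sval b x <= sval a x >].
have [| | |[q [sq qp]] /= qmin] := @ZL_preorder T (exist P p pT) le.
- by move=> t; apply/asboolP.
- move=> a b c /asboolP ab /asboolP bc; apply/asboolP => x.
  exact: le_trans (ab x).
- move=> A Atot; have [A0|/set0P[a0 Aa0]] := eqVneq A set0.
    by exists (exist P p pT) => s; rewrite A0.
  (* Inequality instead of equality closes F under addition: two members of
     the chain are replaced by the smaller one. *)
  pose F h := [set s | exists2 a, A a & sval a h <= s].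
  have Fb h : has_lbound (F h).
    exists (- p (- h)) => s [[a [sa ap]] _ /=]; apply: le_trans.
    by apply: le_trans (sublinear_geN _ h sa); rewrite lerN2.
  have sF : sublinear (fun h => inf (F h)).
    apply: sublinear_inf => //.
    + by move=> h; exists (sval a0 h); exists a0.
    + move=> h k s t [a Aa ahs] [b Ab bkt].
      have /orP[/asboolP ab|/asboolP ba] : le a b || le b a.
        by apply/orP; exact: Atot.
      * exists b => //; have [sb _] := svalP b.
        by apply: le_trans (sb.1 _ _) _; rewrite lerD// (le_trans (ab h)).
      * exists a => //; have [sa _] := svalP a.
        by apply: le_trans (sa.1 _ _) _; rewrite lerD// (le_trans (ba k)).
    + move=> a h s a0' [b Ab bhs]; exists b => //.
      have [sb _] := svalP b.
      by apply: le_trans (sb.2 _ _ a0') _; rewrite ler_wpM2l.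
  have infA b x : A b -> inf (F x) <= sval b x.
    by move=> Ab; apply: ge_inf => //; exists b.
  have Fp : P (fun h => inf (F h)).
    by split=> // x; apply: le_trans (infA _ _ Aa0) _; have [_] := svalP a0.
  by exists (exist P _ Fp) => b Ab; apply/asboolP => x /=; exact: infA.
exists q; split=> // q' sq' q'q.
have q'T : P q'.
  by split=> // x; exact: le_trans (qp x).
by have /asboolP := qmin (exist P q' q'T) (asboolT q'q).
Qed.

(** For fixed v, the functional h |-> inf_(t >= 0) (q (h + t *: v) - t * q v)
    is sublinear and below q, hence equal to q by minimality; its term with
    t = 1 is the claim. *)
Lemma minimal_superadditive q : sublinear q ->
  (forall q', sublinear q' -> (forall x, q' x <= q x) ->
     forall x, q x <= q' x) ->
  forall x y, q x + q y <= q (x + y).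
Proof.
move=> sq qmin x v; have [qD qZ] := sq.
pose F h := [set s | exists2 t, 0 <= t & q (h + t *: v) - t * q v <= s].
have Fb h : has_lbound (F h).
  exists (- q (- h)) => s [t t0]; apply: le_trans.
  have := qD (h + t *: v) (- h); rewrite addrC addKr sublinearZ//.
  by rewrite lerBrDl lerBlDr.
have sF : sublinear (fun h => inf (F h)).
  apply: sublinear_inf => //.
  - by move=> h; eexists; exists 0 => //; exact: lexx.
  - move=> h k s t [a a0 ahs] [b b0 bkt]; exists (a + b); first exact: addr_ge0.
    have := qD (h + a *: v) (k + b *: v).
    by rewrite addrACA -scalerDl; lra.
  - move=> a h s a0 [t t0 hs]; exists (a * t); first exact: mulr_ge0.
    by rewrite -scalerA -scalerDr sublinearZ// -mulrA -mulrBr ler_wpM2l.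
have Fq h : inf (F h) <= q h.
  by apply: ge_inf => //; exists 0 => //; rewrite scale0r addr0 mul0r subr0.
rewrite -lerBrDr; apply: le_trans (qmin _ sF Fq x) _.
by apply: ge_inf => //; exists 1 => //; rewrite scale1r mul1r.
Qed.

Lemma hahn_banach p : sublinear p ->
  exists u : {linear V -> R^o}, forall x, u x <= p x.
Proof.
move=> /sublinear_minimal[q [sq qp qmin]].
have qD x y : q (x + y) = q x + q y.
  by apply/eqP; rewrite eq_le sq.1 minimal_superadditive.
have qN x : q (- x) = - q x.
  by apply/eqP; rewrite -addr_eq0 addrC -qD subrr sublinear0.
have qlin : linear (q : V -> R^o).
  move=> a x y; rewrite qD; congr (_ + _).
  have [a0|a0] := leP 0 a; first exact: sublinearZ.
  rewrite -[a]opprK scaleNr qN sublinearZ ?oppr_ge0 ?ltW//.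
  by rewrite scaleNr.
pose u : {linear V -> R^o} :=
  HB.pack (q : V -> R^o) (GRing.isLinear.Build R V R^o _ (q : V -> R^o) qlin).
by exists u.
Qed.

End sublinear_theory.

(** * Supporting functionals of convex functions *)

Section convex_minorant.
Context {R : realType} {X : normedModType R}.

Lemma norm_bounded_continuous (ell : R) (u : {linear X -> R^o}) :
  (forall h, u h <= ell * `|h|) -> continuous u.
Proof.
move=> u_le; apply: bounded_linear_continuous; apply/linear_boundedP.
near=> M => h; apply: (@le_trans _ _ (ell * `|h|)); last first.
  by rewrite ler_wpM2r//; near: M; apply: nbhs_pinfty_ge; rewrite num_real.
by rewrite ler_norml u_le andbT lerNl -linearN (le_trans (u_le _))// normrN.
Unshelve. all: by end_near. Qed.

(** A norm-cone minorant touching g at x can be replaced by an affine one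
    whose slope has norm at most ell.  Below, [F h] collects the upper bounds
    of the values whose infimum is the sublinear functional to be dominated:
    it is the inf-convolution of [ell * |.|] with the positively homogeneous
    hull of z - x |-> g z - g x. *)
Lemma supporting_functional (D : set X) (g : X -> R) (x : X) (ell : R) :
  (forall z w (a b : R), D z -> D w -> 0 <= a -> 0 <= b -> a + b = 1 ->
     D (a *: z + b *: w) /\ g (a *: z + b *: w) <= a * g z + b * g w) ->
  D x -> 0 <= ell -> (forall z, D z -> g x - ell * `|z - x| <= g z) ->
  exists u : {linear X -> R^o},
    (forall h, u h <= ell * `|h|) /\
    (forall z, D z -> u (z - x) <= g z - g x).
Proof.
move=> gcvx Dx ell0 gx.
pose F h := [set s | exists z t, [/\ D z, 0 <= t &
  t * (g z - g x) + ell * `|h - t *: (z - x)| <= s]].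
have Fb h : has_lbound (F h).
  exists (- (ell * `|h|)) => s [z [t [Dz t0]]]; apply: le_trans.
  have : t * (g x - ell * `|z - x|) <= t * g z by rewrite ler_wpM2l ?gx.
  have : ell * `|t *: (z - x)| <= ell * (`|h| + `|h - t *: (z - x)|).
    by rewrite ler_wpM2l// -[X in `|X| <= _](subKr h) ler_normB.
  by rewrite normrZ ger0_norm//; lra.
have sF : sublinear (fun h => inf (F h)).
  apply: sublinear_inf => //.
  - by move=> h; eexists; exists x, 0; split=> //; exact: lexx.
  - move=> h k s t [z [a [Dz a0 hs]]] [w [b [Dw b0 kt]]].
    (* Two cone points with scales a and b combine into the scale a + b at the
       weighted mean of z and w, unless both scales vanish. *)
    have [ab0|ab0] := eqVneq (a + b) 0.
      have az : a = 0 by lra.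
      have bz : b = 0 by lra.
      exists x, 0; split=> //; move: hs kt.
      rewrite az bz !scale0r !subr0 !mul0r !add0r => hs kt.
      apply: le_trans (lerD hs kt).
      by rewrite -mulrDr ler_wpM2l// ler_normD.
    have abp : 0 < a + b by rewrite lt_neqAle eq_sym ab0 addr_ge0.
    have [] := gcvx z w (a / (a + b)) (b / (a + b)) Dz Dw.
    + by rewrite divr_ge0// ltW.
    + by rewrite divr_ge0// ltW.
    + by rewrite -mulrDl mulfV.
    set y := _ + _ => Dy gy; exists y, (a + b); split=> //; first exact: ltW.
    have -> : (a + b) *: (y - x) = a *: (z - x) + b *: (w - x).
      rewrite /y scalerBr scalerDr !scalerA ![(a + b) * _]mulrC !divfK//.
      by rewrite !scalerBr scalerDl opprD addrACA.
    have : (a + b) * g y <= a * g z + b * g w.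
      rewrite -ler_pdivlMl//; apply: le_trans gy _.
      by rewrite mulrDr !mulrA ![_^-1 * _]mulrC.
    have : ell * `|h + k - (a *: (z - x) + b *: (w - x))| <=
      ell * (`|h - a *: (z - x)| + `|k - b *: (w - x)|).
      by rewrite ler_wpM2l// opprD addrACA ler_normD.
    by lra.
  - move=> a h s a0 [z [t [Dz t0 hs]]]; exists z, (a * t).
    split; [by []|exact: mulr_ge0|].
    rewrite -scalerA -scalerBr normrZ ger0_norm//.
    rewrite mulrCA -[a * t * _]mulrA -mulrDr.
    exact: ler_wpM2l.
have [u up] := hahn_banach _ sF; exists u; split=> [h|z Dz].
  apply: le_trans (up h) _; apply: ge_inf => //; exists x, 0; split=> //.
  by rewrite scale0r subr0 mul0r add0r.
apply: le_trans (up _) _; apply: ge_inf => //; exists z, 1; split=> //.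
by rewrite scale1r mul1r subrr normr0 mulr0 addr0.
Qed.

End convex_minorant.

(** * Convex functions with values in the extended reals *)

Section convex_fun_theory.
Context {R : realType} {X : normedModType R}.
Implicit Types (f : X -> \bar R) (x y z : X).

Lemma convex_fun_dom f z w (a b : R) : (forall x, f x != -oo%E) ->
  convex_fun f -> edom f z -> edom f w -> 0 <= a -> 0 <= b -> a + b = 1 ->
  edom f (a *: z + b *: w) /\
  fine (f (a *: z + b *: w)) <= a * fine (f z) + b * fine (f w).
Proof.
move=> fN fc fz fw a0 b0 ab.
have a1 : a <= 1 by rewrite -ab lerDl.
have i01a : Itv.spec (@Itv.num_sem R) (Itv.Real `[0%Z, 1%Z]) a.
  by apply/and3P; split; rewrite ?num_real//= bnd_simp.
have := fc (z, fine (f z)) (w, fine (f w)) (Itv.mk i01a).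
rewrite !inE /epigraph /= !fineK// => /(_ (lexx _) (lexx _)).
have -> : b = 1 - a by rewrite -ab addrC addKr.
move=> h.
have fd : edom f (a *: z + (1 - a) *: w).
  rewrite /edom/= fin_numE fN/= -ltey.
  exact: le_lt_trans h (ltry _).
by split=> //; rewrite -lee_fin fineK.
Qed.

Lemma segmentBl x y (t : R) : (1 - t) *: x + t *: y - x = t *: (y - x).
Proof.
by rewrite scalerBl scale1r scalerBr addrAC [x - _]addrC addrK addrC.
Qed.

Lemma segmentBr x y (t : R) :
  y - ((1 - t) *: x + t *: y) = (1 - t) *: (y - x).
Proof.
by rewrite -[LHS](subrKA x) -[x - _]opprB segmentBl scalerBl scale1r.
Qed.

Lemma ball_segment (xbar x y : X) (r t : R) : 0 <= t <= 1 ->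
  ball xbar r x -> ball xbar r y -> ball xbar r ((1 - t) *: x + t *: y).
Proof.
move=> /andP[t0 t1]; rewrite -!ball_normE /= => hx hy.
have -> : xbar - ((1 - t) *: x + t *: y) =
    (1 - t) *: (xbar - x) + t *: (xbar - y).
  by rewrite !scalerBr addrACA -scalerDl subrK scale1r opprD.
apply: le_lt_trans (ler_normD _ _) _.
rewrite !normrZ !ger0_norm ?subr_ge0//.
have : Num.max `|xbar - x| `|xbar - y| < r by rewrite gt_max hx.
have : `|xbar - x| <= Num.max `|xbar - x| `|xbar - y| by rewrite le_max lexx.
have : `|xbar - y| <= Num.max `|xbar - x| `|xbar - y|.
  by rewrite le_max lexx orbT.
nra.
Qed.

(** Points of the domain outside the ball are reached from the ball through
    the initial piece of a segment; this is how local information at x becomes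
    global by convexity. *)
Lemma ball_segment_start (xbar x y : X) (r : R) : ball xbar r x ->
  exists t, 0 < t <= 1 /\ ball xbar r ((1 - t) *: x + t *: y).
Proof.
rewrite -!ball_normE /= -subr_gt0; set d := r - _ => d0.
have dN : 0 < d + `|y - x| by rewrite ltr_pwDl.
pose t := d / (d + `|y - x|).
have t0 : 0 < t by rewrite divr_gt0.
exists t; split; first by rewrite t0 /t ler_pdivrMr// mul1r lerDl normr_ge0.
rewrite -[xbar - _](subrKA x) -[x - _]opprB segmentBl.
apply: le_lt_trans (ler_normB _ _) _.
rewrite normrZ gtr0_norm// addrC -ltrBrDr -/d.
by rewrite /t -mulrA gtr_pMr// mulrC ltr_pdivrMr// mul1r ltrDr.
Qed.

(** Outside the domain the value is +oo, where the subgradient inequality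
    holds automatically. *)
Lemma subdifferentialE f x (u : {linear X -> R^o}) :
  (forall x, f x != -oo%E) -> edom f x ->
  subdifferential f x u <->
  continuous u /\
  forall y, edom f y -> u (y - x) <= fine (f y) - fine (f x).
Proof.
move=> fN fx; split=> -[uc ux]; split=> // y.
  by move=> fy; have := ux y; rewrite -(fineK fx) -(fineK fy) -EFinB lee_fin.
have := fN y; case fyE : (f y) => [s| |]// _; last first.
  by rewrite -(fineK fx) addye// leey.
have fy : edom f y by rewrite /edom/= fyE.
by rewrite -(fineK fx) -EFinB lee_fin; have := ux _ fy; rewrite fyE.
Qed.

(** The point (y, c + d) is the limit of points of the closed epigraph.
    Convexity could not replace closedness here, since a convex function may
    jump up at the end of a segment. *)
Lemma lsc_fun_closed_segment f x y (c d : R) : lsc_fun f ->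
  (forall t, 0 <= t < 1 ->
     (f ((1 - t) *: x + t *: y)%R <= (c + t * d)%:E)%E) ->
  (f y <= (c + d)%:E)%E.
Proof.
move=> flsc fle.
pose p (t : R) : X * R^o := ((1 - t) *: x + t *: y, c + t * d).
have pcvg : p t @[t --> (1 : R)^'-] --> p 1.
  have cvg_fst_p : (p t).1 @[t --> (1 : R)] --> (p 1).1.
    apply: cvgD; apply: cvgZr_tmp; last exact: cvg_id.
    by apply: cvgB; [exact: cvg_cst|exact: cvg_id].
  have cvg_snd_p : (p t).2 @[t --> (1 : R)] --> (p 1).2.
    by apply: cvgD; [exact: cvg_cst|apply: cvgMr_tmp; exact: cvg_id].
  by apply: cvg_within_filter; exact: cvg_pair cvg_fst_p cvg_snd_p.
have : epigraph f (p 1).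
  apply: (closed_cvg (epigraph f) flsc _ _ pcvg).
  near=> t; apply: fle; apply/andP; split=> //.
  by near: t; exact: nbhs_left_ge.
by rewrite /epigraph/= subrr scale0r add0r scale1r mul1r.
Unshelve. all: by end_near. Qed.

End convex_fun_theory.

(** * Local Lipschitz continuity and normals to the domain *)

Theorem theorem3p2 (R : realType) (X : completeNormedModType R)
    (f : X -> \bar R) (xbar : X) (r ell : R)
    (f_neqNy : forall x, f x != -oo%E)
    (f_proper : proper_fun f) (f_lsc : lsc_fun f)
    (f_convex : convex_fun f)
    (xbar_dom : edom f xbar) (r_gt0 : 0 < r) (ell_ge0 : 0 <= ell) :
  [<-> (* (i) *)
       lipschitz_finite ell (edom f `&` ball xbar r) f;
       (* (a) *)
       forall x, (edom f `&` ball xbar r) x ->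
         subdifferential f x !=set0 /\
         subdifferential f x `<=` eps_normals ell x (edom f);
       (* (b) *)
       forall x, (edom f `&` ball xbar r) x ->
         subdifferential f x `&` eps_normals ell x (edom f) !=set0].
Proof.
have cvx z w a b fz fw := convex_fun_dom f z w a b f_neqNy f_convex fz fw.
tfae.
- move=> [_ lip] x [fx Bx].
  have near_x y : edom f y -> exists t, [/\ 0 < t, t <= 1,
      edom f ((1 - t) *: x + t *: y),
      fine (f ((1 - t) *: x + t *: y)) <= (1 - t) * fine (f x) + t * fine (f y)
    & `|fine (f ((1 - t) *: x + t *: y)) - fine (f x)| <= t * (ell * `|y - x|)].
    move=> fy; have [t [/andP[t0 t1] Bt]] := ball_segment_start _ _ y _ Bx.
    have [|||fz zle] := cvx x y (1 - t) t fx fy.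
    + by rewrite subr_ge0.
    + exact: ltW.
    + exact: subrK.
    exists t; split=> //.
    have /= := lip (_, x) (conj (conj fz Bt) (conj fx Bx)).
    move=> /le_trans; apply.
    by rewrite segmentBl normrZ gtr0_norm// mulrCA.
  split.
    have [||||u [u_le ux]] := supporting_functional (edom f) (fine \o f) x ell.
    + by move=> z w a b; exact: cvx.
    + by [].
    + by [].
    (* Dividing by t the two bounds on the increment of f along the initial
       piece: at most t * (f y - f x) by convexity, at least
       - t * ell * |y - x| by the Lipschitz hypothesis. *)
    + move=> y /near_x[t [t0 _ _]] /=; rewrite ler_norml => zle /andP[lez _].
      by rewrite -(ler_pM2l t0); lra.
    exists u; apply/subdifferentialE => //; split=> //.
    exact: norm_bounded_continuous u_le.
  move=> u /(subdifferentialE _ _ _ f_neqNy fx)[uc ux]; split=> // y.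
  move=> /near_x[t [t0 _ fz _]]; rewrite ler_norml => /andP[_ zle].
  rewrite -(ler_pM2l t0); apply: le_trans zle; apply: le_trans (ux _ fz).
  by rewrite segmentBl linearZ.
- by move=> ax x /ax[[u xu] sub]; exists u; split=> //; exact: sub.
- move=> bx.
  have le x y : (edom f `&` ball xbar r) x -> (edom f `&` ball xbar r) y ->
      fine (f y) - fine (f x) <= ell * `|y - x|.
    move=> [fx Bx] [fy By]; rewrite lerBlDl -lee_fin fineK//.
    apply: (lsc_fun_closed_segment f x y) => // t /andP[t0 t1].
    have [|||fz _] := cvx x y (1 - t) t fx fy => //.
    + by rewrite subr_ge0 ltW.
    + exact: subrK.
    have Bz : ball xbar r ((1 - t) *: x + t *: y).
      by apply: ball_segment => //; rewrite t0 ltW.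
    have [u [/(subdifferentialE _ _ _ f_neqNy fz)[_ uz] [_ nz]]] :=
      bx _ (conj fz Bz).
    have := uz _ fx; have := nz _ fy.
    rewrite segmentBr -[x - _]opprB segmentBl linearN !linearZ/= normrZ ger0_norm ?subr_ge0 ?(ltW t1)//.
    rewrite mulrCA ler_pM2l ?subr_gt0// => uyx.
    rewrite -[X in (X <= _)%E](fineK fz) lee_fin.
    have : t * u (y - x) <= t * (ell * `|y - x|) by rewrite ler_wpM2l.
    rewrite /GRing.scale/=; lra.
  split; first by move=> x [].
  move=> [x y] /= [Cx Cy]; rewrite ler_norml lerNl opprB.
  by rewrite {1}distrC !le.
Qed.
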